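(* Let $L\ge 1$ and $N_c\ge 1$ be integers and consider the uplink of the locally connected network with connectivity parameter $L$ described in the context, with cell association constraint $|\mathcal C_i|\le N_c$ for all $i$, restricted to zero-forcing message passing decoding schemes. Then the zero-forcing uplink per user degrees of freedom satisfy \[ \tau_U^{\mathrm{zf}}(L,N_c)=\begin{cases}1, & L+1\le N_c,\\[2pt] \dfrac{N_c+1}{L+2}, & \dfrac{L}{2}\le N_c\le L,\\[6pt] \dfrac{2N_c}{2N_c+L}, & 1\le N_c<\dfrac{L}{2}.\end{cases} \]
   Context: Network: $K$ base stations BS $1,\dots,K$ and $K$ mobile terminals MT $1,\dots,K$, each with a single antenna. For the connectivity parameter $L$, the channel coefficient $H_{i,j}$ between MT $i$ and BS $j$ is zero if and only if $i\notin\{j,j+1,\dots,j+L\}$; the nonzero coefficients are drawn from a continuous joint distribution (results hold for almost all realizations) and global channel state information is available everywhere. In the uplink, BS $j$ receives $Y_j=\sum_{i}H_{i,j}X_i+Z_j$, where $X_i$ is the signal of MT $i$ (average power constraint $P$) and $Z_j$ is unit-variance Gaussian noise. MT $i$ has message $W_i$. A cell association assigns to each MT $i$ a set $\mathcal C_i\subseteq[K]$ of base stations with $|\mathcal C_i|\le N_c$. Only whole (decoded) messages can be exchanged over the backhaul: a message $W_i$ may be decoded at one base station in $\mathcal C_i$ and passed to the other base stations in $\mathcal C_i$, which may use it to cancel its interference. Zero-forcing (message passing decoding) uplink scheme: each active MT uses a point-to-point Gaussian code of power $P$ and each active message gets one degree of freedom; BS $i$ is active if there is $j$ with $i\in\mathcal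 C_j$ such that, given the messages $B_i$ that BS $i$ has received over the backhaul (messages decoded elsewhere and associated with BS $i$), the noiseless received signal $Y_i-Z_i$ depends on $W_j$ and on no other message (i.e. all other interference is cancelled using $B_i$); then $W_j$ is decoded at BS $i$ and (MT $j$, BS $i$) is called a decoding pair. Each message is decoded at at most one base station. Degrees of freedom: $d_i=\lim_{P\to\infty}R_i(P)/\log P$, the sum DoF $\eta$ is the maximum of $\sum_i d_i$, and $\tau_U^{\mathrm{zf}}(L,N_c)=\lim_{K\to\infty}\eta_U^{\mathrm{zf}}(K,L,N_c)/K$, where $\eta_U^{\mathrm{zf}}(K,L,N_c)$ is the maximum uplink sum DoF over all cell associations satisfying the constraint and all zero-forcing message passing decoding schemes. *)

(* Defs.v *)
From mathcomp Require Import all_boot.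
From Stdlib Require Import Reals.

Set Implicit Arguments.
Unset Strict Implicit.
Unset Printing Implicit Defensive.

(* Indices are 0-based: MT j and BS i range over 'I_K.
   H_{j,i} <> 0  iff  i <= j <= i + L  (MT j is heard by BS i).
   For almost all channel realizations the noiseless signal of BS i
   depends exactly on the messages of the active MTs connected to it. *)
Definition connected (L : nat) (K : nat) (j i : 'I_K) : bool :=
  (i <= j <= i + L)%N.

(* Cell association: C j = set of BSs associated with MT j, |C j| <= Nc. *)
Definition assoc_ok (K Nc : nat) (C : {ffun 'I_K -> {set 'I_K}}) : bool :=
  [forall j, #|C j| <= Nc].

(* A zero-forcing (message passing decoding) uplink scheme:
   dec j = Some i  means W_j is decoded at BS i (MT j active, (j,i) a
   decoding pair); dec j = None means MT j is inactive (silent).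
   r is a decoding time (strict order of decoding), forbidding cyclic
   use of backhaul messages.  Condition for a decoding pair (j,i):
   i \in C j, W_j is heard at BS i, and every other active message m heard
   at BS i is in B_i, i.e. was decoded earlier at a BS k <> i and i \in C m. *)
Definition zf_valid (K L : nat) (C : {ffun 'I_K -> {set 'I_K}})
    (dec : {ffun 'I_K -> option 'I_K}) (r : {ffun 'I_K -> 'I_K}) : bool :=
  [forall j, forall i, (dec j == Some i) ==>
     [&& i \in C j, connected L j i &
       [forall m, [&& m != j, connected L m i & dec m != None] ==>
          [&& [exists k, (dec m == Some k) && (k != i)],
              i \in C m & (r m < r j)%N]]]].

Definition zf_dof (K : nat) (dec : {ffun 'I_K -> option 'I_K}) : nat :=
  #|[set j | dec j != None]|.

Definition eta_zf (K L Nc : nat) : nat :=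
  \max_(x : {ffun 'I_K -> {set 'I_K}} *
            ({ffun 'I_K -> option 'I_K} * {ffun 'I_K -> 'I_K})
        | assoc_ok Nc x.1 && zf_valid L x.1 x.2.1 x.2.2)
     zf_dof x.2.1.

Definition tau_seq (L Nc : nat) : nat -> R :=
  fun K => (INR (eta_zf K L Nc) / INR K)%R.

(* Main.v *)
Require Import Defs.
From mathcomp Require Import all_boot.
From Stdlib Require Import Reals.
From Stdlib Require Import Lra.
From mathcomp Require Import zify.

(* List the active terminals as a_0 < a_1 < ... and let d_k be the station that
   decodes a_k.  Two terminals cannot each be heard at the station decoding the
   other, so d is increasing and, for each k, either d_k is deaf to a_{k+1} or
   d_{k+1} is deaf to a_k: call k deaf ahead or deaf behind.  All stations d_k
   hearing a_m lie in C(a_m), so at most N of them do.  This yields two kinds of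
   steep jumps along d: d_{x+N+1} >= d_x + L + 2 if x is deaf ahead or x + N is deaf
   behind, and d_y >= d_x + L + (y - x) if a deaf-ahead index and then a deaf-behind
   one lie between x and y.
   The former realise the slope (L + 2) / (N + 1), the latter, of length at most
   2 N, a slope of at least (L + 2 N) / (2 N); the point is that such jumps can be
   chained from one end of the sequence to the other.  The lower bounds come from
   explicit periodic schemes. *)

Set Implicit Arguments.
Unset Strict Implicit.
Unset Printing Implicit Defensive.

Lemma modnB_small p m k : k <= m %% p -> (m - k) %% p = m %% p - k.
Proof.
case: p => [|p] le_k; first by rewrite !modn0.
have lt_kp : k < p.+1 by apply: leq_ltn_trans le_k _; rewrite ltn_mod.
rewrite modnB // ?(leq_trans le_k) ?leq_mod // (modn_small lt_kp).
by rewrite ltnNge le_k mul0n.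
Qed.

Lemma count_iota_const (P : pred nat) (b : bool) m n :
  (forall o, m <= o < m + n -> P o = b) -> count P (iota m n) = b * n.
Proof.
move=> P_b; have /eq_in_count-> : {in iota m n, P =1 fun=> b}.
  by move=> o; rewrite mem_iota => /P_b.
by case: b {P_b}; rewrite ?count_predT ?count_pred0 ?size_iota ?mul1n.
Qed.

Lemma leq_count_periodic (P : pred nat) p K : 0 < p ->
    (forall j, P (j %% p) = P j) ->
  K * count P (iota 0 p) <= count P (iota 0 K) * p + p * count P (iota 0 p).
Proof.
move=> p_gt0 P_mod.
have count_block t : count P (iota (t * p) p) = count P (iota 0 p).
  rewrite -[t * p]addn0 iotaDl count_map; apply: eq_count => o.
  by rewrite /= -P_mod modnMDl P_mod.
have count_blocks t : count P (iota 0 (t * p)) = t * count P (iota 0 p).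
  by elim: t => // t IHt; rewrite mulSnr iotaD count_cat IHt count_block mulSnr.
have : K %/ p * count P (iota 0 p) <= count P (iota 0 K).
  by rewrite [in iota 0 K](divn_eq K p) iotaD count_cat count_blocks leq_addr.
have := divn_eq K p; have := ltn_pmod K p_gt0.
by move: (count P (iota 0 p)) (count P _) (K %/ p) (K %% p); nia.
Qed.

Lemma sorted_enum_set n (A : {set 'I_n}) :
  sorted ltn [seq nat_of_ord j | j <- enum A].
Proof.
have ltn_tr : transitive ltn by apply: ltn_trans.
apply: (subseq_sorted ltn_tr _ (iota_ltn_sorted 0 n)).
by rewrite -val_enum_ord map_subseq // enumT /enum_mem filter_subseq.
Qed.

Lemma strictly_increasing_gap n (f : nat -> nat) :
    (forall k, k.+1 < n -> f k < f k.+1) ->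
  forall i j, i <= j < n -> f i + j <= f j + i.
Proof.
move=> f_incr i; elim=> [|j IHj] /andP[le_ij lt_jn]; first by case: i le_ij.
case: (ltngtP i j.+1) le_ij => // [lt_ij | -> //] _.
by have := f_incr j lt_jn; have := IHj ltac:(lia); lia.
Qed.

(* [a k] is the [k]-th active terminal and [d k] the station decoding it; two
   terminals are never both heard at each other's decoding stations. *)
Record decoding_chain (L n : nat) (d a : nat -> nat) : Prop := DecodingChain {
  chain_range : forall k, k < n -> d k <= a k <= d k + L;
  chain_terminal_incr : forall k, k.+1 < n -> a k < a k.+1;
  chain_step : forall k, k.+1 < n -> (d k + L < a k.+1) || (a k < d k.+1)
}.

(* [a m] is not heard by all of the [N.+1] stations [d s, ..., d (s + N)]. *)
Definition bounded_overlap (L N n : nat) (d a : nat -> nat) : Prop :=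
  forall s m, s <= m <= s + N -> s + N < n ->
    (d s + L < a m) || (a m < d (s + N)).

Section DecodingChain.

Variables (L n : nat) (d a : nat -> nat).
Hypothesis chain : decoding_chain L n d a.

Lemma chain_station_incr k : k.+1 < n -> d k < d k.+1.
Proof.
move=> lt_kn; have := chain_step chain lt_kn.
by have := chain_range chain lt_kn; have := chain_range chain (ltnW lt_kn); lia.
Qed.

Lemma chain_station_gap i j : i <= j < n -> d i + j <= d j + i.
Proof. by apply: strictly_increasing_gap; apply: chain_station_incr. Qed.

Lemma chain_terminal_gap i j : i <= j < n -> a i + j <= a j + i.
Proof. by apply: strictly_increasing_gap; apply: chain_terminal_incr chain. Qed.

Definition deaf_ahead k := d k + L < a k.+1.

Lemma deaf_behind k : k.+1 < n -> ~~ deaf_ahead k -> a k < d k.+1.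
Proof.
by move=> /(chain_step chain) + /negbTE hears_ahead; rewrite [_ < _]hears_ahead.
Qed.

Lemma deaf_ahead_behind_gap x k l : x <= k -> k < l -> l.+1 < n ->
  deaf_ahead k -> ~~ deaf_ahead l -> d x + L + l.+1 <= d l.+1 + x.
Proof.
rewrite /deaf_ahead => le_xk lt_kl lt_ln ahead_k /(deaf_behind lt_ln) behind_l.
have := @chain_station_gap x k ltac:(lia).
by have := @chain_terminal_gap k.+1 l ltac:(lia); lia.
Qed.

Variable N : nat.
Hypothesis N_gt0 : 0 < N.
Hypothesis overlap : bounded_overlap L N n d a.

Definition wide x := d x + L + 2 <= d (x + N.+1).

Lemma wide_deaf_ahead x : x + N.+1 < n -> deaf_ahead x -> wide x.
Proof.
rewrite /wide /deaf_ahead => lt_xn ahead_x.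
have := chain_range chain (ltac:(lia) : x.+1 < n).
have := overlap (ltac:(lia) : x.+1 <= x.+1 <= x.+1 + N).
by rewrite addSnnS; lia.
Qed.

Lemma wide_deaf_behind x : x + N.+1 < n -> ~~ deaf_ahead (x + N) -> wide x.
Proof.
rewrite /wide addnS => lt_xn /(deaf_behind lt_xn) behind_x.
have := chain_range chain (ltnW lt_xn).
by have := overlap (ltac:(lia) : x <= x + N <= x + N); lia.
Qed.

(* [d (u - j)] is the last station too far below [a u] to hear it. *)
Lemma wide_around u : N <= u -> u + N < n ->
  exists2 j, 0 < j <= N & wide (u - j).
Proof.
move=> le_Nu lt_un.
have range_u := chain_range chain (ltac:(lia) : u < n).
have ex_far : exists j, (j <= N) && (d (u - j) + L < a u).
  exists N; rewrite leqnn /=.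
  by have := overlap (ltac:(lia) : u - N <= u <= u - N + N); rewrite subnK //; lia.
case: (ex_minnP ex_far) => -[|j] /andP[le_jN far_j] min_j.
  by move: far_j; rewrite subn0; lia.
exists j.+1; first by rewrite le_jN.
have near_j : ~~ (d (u - j) + L < a u).
  by apply/negP => far_j'; have := min_j j; rewrite far_j' andbT; lia.
have := overlap (ltac:(lia) : u - j <= u <= u - j + N).
by rewrite (negbTE near_j) /wide (_ : u - j.+1 + N.+1 = u - j + N); lia.
Qed.

Section Slope.

Variables p q : nat.
Hypothesis slope_wide : N.+1 * p <= (L + 2) * q.
Hypothesis slope_jump : 2 * N * p <= (L + 2 * N) * q.

(* [p / q * (y - x) <= d y - d x], without subtraction. *)
Definition steep x y := d x * q + y * p <= d y * q + x * p.

Lemma steep_trans y x z : steep x y -> steep y z -> steep x z.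
Proof. by rewrite /steep; lia. Qed.

Lemma steep_wide x : wide x -> steep x (x + N.+1).
Proof.
rewrite /wide /steep => wide_x.
have : (d x + L + 2) * q <= d (x + N.+1) * q by rewrite leq_mul2r wide_x orbT.
by move: slope_wide; rewrite !mulnDl; lia.
Qed.

Lemma slope_jump_le z : z <= 2 * N -> z * p <= (L + z) * q.
Proof.
move=> le_z; case: (leqP p q) => [le_pq|/ltnW le_qp]; first by nia.
have : z * (p - q) <= 2 * N * (p - q) by rewrite leq_mul2r le_z orbT.
by move: slope_jump; rewrite !mulnBr !mulnDl; nia.
Qed.

Lemma steep_deaf_ahead_behind x k l :
    x <= k -> k < l -> l.+1 < n -> l.+1 <= x + 2 * N ->
  deaf_ahead k -> ~~ deaf_ahead l -> steep x l.+1.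
Proof.
move=> le_xk lt_kl lt_ln le_lx ahead_k behind_l.
have := deaf_ahead_behind_gap le_xk lt_kl lt_ln ahead_k behind_l.
have := @slope_jump_le (l.+1 - x) ltac:(lia); rewrite /steep.
have [z ->] : exists z, l.+1 = x + z by exists (l.+1 - x); lia.
rewrite addKn => slope_z gap_z.
have : (d x + L + z) * q <= d (x + z) * q by rewrite leq_mul2r; lia.
by move: slope_z; rewrite !mulnDl; lia.
Qed.

Definition near_end k := n <= k + (2 * N).+1.

Definition climbs_to_end x := exists2 y, near_end y && (y < n) & steep x y.

Lemma climbs_near_end x : x < n -> near_end x -> climbs_to_end x.
Proof. by move=> lt_xn end_x; exists x; rewrite ?end_x /steep. Qed.

Lemma climbs_steep y x : steep x y -> climbs_to_end y -> climbs_to_end x.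
Proof.
by move=> steep_xy [z end_z steep_yz]; exists z => //; apply: steep_trans steep_yz.
Qed.

Lemma next_deaf_ahead y : y + 2 * N < n ->
  exists u, [/\ y <= u, u + 2 * N < n, deaf_ahead u || near_end u
    & forall i, y <= i < u -> ~~ deaf_ahead i].
Proof.
move=> lt_yn.
have ex_u : exists u, (y <= u) && (deaf_ahead u || near_end u).
  by exists (n - (2 * N).+1); rewrite /near_end; lia.
case: (ex_minnP ex_u) => u /andP[le_yu stop_u] min_u; exists u; split=> //.
  by have := min_u (n - (2 * N).+1); rewrite /near_end; lia.
move=> i /andP[le_yi lt_iu]; apply/negP => ahead_i.
by have := min_u i; rewrite le_yi ahead_i; lia.
Qed.

Lemma climbs_residue y w u : y <= w <= u -> u < n ->
    (forall i, y <= i < u -> ~~ deaf_ahead i) ->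
  climbs_to_end w -> climbs_to_end (y + (w - y) %% N.+1).
Proof.
move=> /andP[le_yw le_wu] lt_un behind climbs_w.
have [z] := ubnP (w - y).
elim: z w le_yw le_wu climbs_w => // z IHz w le_yw le_wu climbs_w lt_z.
case: (ltnP (w - y) N.+1) => [lt_wN|le_Nw]; first by rewrite modn_small // subnKC.
have -> : w - y = w - N.+1 - y + N.+1 by lia.
rewrite modnDr; apply: IHz; try lia.
apply: climbs_steep (steep_wide _) _; last by rewrite subnK //; lia.
by apply: wide_deaf_behind; [lia | apply: behind; lia].
Qed.

Lemma climbs_over_deaf_ahead x k w u :
    x <= k <= x + N -> deaf_ahead k -> wide x ->
    x + N.+1 <= w <= u -> u < n ->
    (forall i, x + N.+1 <= i < u -> ~~ deaf_ahead i) ->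
    (w - (x + N.+1)) %% N.+1 != N ->
  climbs_to_end w -> climbs_to_end x.
Proof.
move=> le_k ahead_k wide_x le_w lt_un behind neq_N climbs_w.
have := climbs_residue le_w lt_un behind climbs_w.
have := leq_mod (w - (x + N.+1)) N.+1; have := ltn_mod (w - (x + N.+1)) N.+1.
case: (_ %% _) neq_N => [|r] neq_N lt_r le_r.
  by rewrite addn0; apply: climbs_steep; apply: steep_wide.
rewrite addnS; apply/climbs_steep/(@steep_deaf_ahead_behind _ k); try lia.
by apply: behind; lia.
Qed.

(* From [x] one climbs to [x + N.+1] and to all of [x + N.+2, ..., x + 2 * N] that
   lie before the next deaf-ahead index [u]: one residue class modulo [N.+1] is
   missed.  But [u] and the wide index [u - j] lie in different classes. *)
Lemma climbs_wide_near_deaf_ahead x k : x <= k <= x + N -> x + N.+1 < n ->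
  wide x -> deaf_ahead k || near_end k -> climbs_to_end x.
Proof.
have [z] := ubnP (n - x); elim: z x k => // z IHz x k lt_z le_k lt_xn wide_x stop_k.
have [end_x|] := boolP (near_end (x + N.+1)).
  by apply: climbs_steep (steep_wide wide_x) (climbs_near_end lt_xn end_x).
rewrite -ltnNge => lt_x.
have {stop_k} ahead_k : deaf_ahead k by case/orP: stop_k => //; rewrite /near_end; lia.
have [u [le_u lt_un stop_u behind]] := @next_deaf_ahead (x + N.+1) ltac:(lia).
have climbs_over w := @climbs_over_deaf_ahead x k w u le_k ahead_k wide_x.
case: (eqVneq ((u - (x + N.+1)) %% N.+1) N) => [mod_u|neq_u]; last first.
  apply: (climbs_over u) => //; try lia.
  case/orP: stop_u => [ahead_u|end_u]; last by apply: climbs_near_end => //; lia.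
  by apply: (IHz u u); rewrite ?ahead_u ?wide_deaf_ahead //; lia.
have := leq_mod (u - (x + N.+1)) N.+1; rewrite mod_u => le_N.
have [j le_j wide_j] := @wide_around u ltac:(lia) ltac:(lia).
apply: (climbs_over (u - j)) => //; try lia.
  by rewrite subnAC modnB_small mod_u; lia.
by apply: (IHz (u - j) u); lia.
Qed.

Lemma climbs_from_start : 0 < n -> exists2 x, x <= N & climbs_to_end x.
Proof.
move=> n_gt0; have [end_0|] := boolP (near_end 0).
  by exists 0 => //; apply: climbs_near_end.
rewrite -ltnNge => lt_n.
have [u [_ lt_un stop_u behind]] := @next_deaf_ahead 0 ltac:(lia).
have climbs_u : climbs_to_end u.
  case/orP: stop_u => [ahead_u|end_u]; last by apply: climbs_near_end => //; lia.
  by apply: (@climbs_wide_near_deaf_ahead u u); rewrite ?ahead_u ?wide_deaf_ahead //; lia.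
have := @climbs_residue 0 u u ltac:(lia) ltac:(lia) behind climbs_u.
rewrite add0n subn0; exists (u %% N.+1) => //.
by rewrite -ltnS ltn_mod.
Qed.

Lemma chain_length_le K : (forall k, k < n -> d k < K) ->
  n * p <= K * q + (3 * N + 1) * p.
Proof.
move=> d_lt; have [-> //|n_gt0] := posnP n.
have [x le_xN [y /andP[end_y lt_yn] steep_xy]] := climbs_from_start n_gt0.
have : n * p <= (y + (2 * N).+1) * p by apply: leq_mul.
have : x * p <= N * p by apply: leq_mul.
have : d y * q <= K * q by rewrite leq_mul // ltnW ?d_lt.
by move: steep_xy; rewrite /steep !mulnDl; lia.
Qed.

End Slope.

End DecodingChain.

Definition listening_stations K L (dec : {ffun 'I_K -> option 'I_K})
    (m : 'I_K) : {set 'I_K} :=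
  [set i | connected L m i & [exists j, dec j == Some i]].

(* The cell association is eliminated: [C m] may as well be the set of decoding
   stations that hear [m]. *)
Record zf_schedule K L N (dec : {ffun 'I_K -> option 'I_K})
    (r : {ffun 'I_K -> 'I_K}) : Prop := ZfSchedule {
  zf_connected : forall j i, dec j = Some i -> connected L j i;
  zf_decoded_before : forall j i m, dec j = Some i -> dec m != None -> m != j ->
    connected L m i -> r m < r j;
  zf_listening_le : forall m, dec m != None -> #|listening_stations L dec m| <= N
}.

Lemma zf_scheduleP K L N (dec : {ffun 'I_K -> option 'I_K}) r :
  zf_schedule L N dec r <-> exists2 C, assoc_ok N C & zf_valid L C dec r.
Proof.
split=> [[conn before listen_le] | [C /forallP C_le valid]].
  exists [ffun m => if dec m == None then set0 else listening_stations L dec m].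
    apply/forallP => m; rewrite ffunE; case: eqP => [_ | /eqP/listen_le //].
    by rewrite cards0.
  apply/forallP => j; apply/forallP => i; apply/implyP => /eqP dec_j.
  have dec_i : [exists j, dec j == Some i] by apply/existsP; exists j; rewrite dec_j.
  rewrite ffunE dec_j /= inE dec_i (conn j i dec_j) /=.
  apply/forallP => m; apply/implyP => /and3P[neq_mj conn_mi act_m].
  have lt_mj := before j i m dec_j act_m neq_mj conn_mi.
  rewrite lt_mj ffunE (negbTE act_m) inE dec_i conn_mi /= andbT.
  case dec_m: (dec m) act_m => [k|] // _; apply/existsP; exists k.
  rewrite eqxx /=; apply/eqP => eq_ki; rewrite eq_ki in dec_m.
  suff : r j < r m by rewrite ltnNge ltnW.
  by apply: (before _ _ _ dec_m _ _ (conn j i dec_j)); rewrite ?dec_j // eq_sym.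
have valid_at j i : dec j = Some i -> [&& i \in C j, connected L j i &
    [forall m, [&& m != j, connected L m i & dec m != None] ==>
      [&& [exists k, (dec m == Some k) && (k != i)], i \in C m & r m < r j]]].
  by move=> dec_j; have /forallP/(_ j)/forallP/(_ i) := valid; rewrite dec_j eqxx.
split=> [j i /valid_at/and3P[] // | j i m /valid_at/and3P[_ _ /forallP/(_ m)] | m act_m].
  by move=> + act_m neq_mj conn_mi; rewrite neq_mj act_m conn_mi => /and3P[].
apply: leq_trans (C_le m); apply/subset_leq_card/subsetP => i.
rewrite inE => /andP[conn_mi /existsP[j /eqP/valid_at/and3P[j_C _ /forallP/(_ m)]]].
by case: (eqVneq m j) j_C => [-> // | _ _]; rewrite conn_mi act_m => /and3P[].
Qed.

Lemma eta_zf_leqP K L N B :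
  reflect (forall dec r, zf_schedule L N dec r -> @zf_dof K dec <= B)
          (eta_zf K L N <= B).
Proof.
rewrite /eta_zf; apply: (iffP (bigmax_leqP _ _ _)) => dof_le.
  move=> dec r /zf_scheduleP[C C_ok valid].
  by apply: (dof_le (C, (dec, r))); rewrite C_ok.
case=> [C [dec r]] /andP[C_ok valid]; apply: (dof_le dec r).
by apply/zf_scheduleP; exists C.
Qed.

Lemma zf_dof_le_eta K L N (dec : {ffun 'I_K -> option 'I_K}) r :
  zf_schedule L N dec r -> zf_dof dec <= eta_zf K L N.
Proof. exact/eta_zf_leqP. Qed.

Lemma eta_zf_le K L N : eta_zf K L N <= K.
Proof. by apply/eta_zf_leqP => dec r _; rewrite (leq_trans (max_card _)) ?card_ord. Qed.

Section ScheduleChain.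

Variables (K L N : nat).
Variables (dec : {ffun 'I_K -> option 'I_K}) (r : {ffun 'I_K -> 'I_K}).
Hypothesis schedule : zf_schedule L N dec r.

Definition active_terminal : nat -> nat :=
  nth 0 [seq nat_of_ord j | j <- enum [set j | dec j != None]].

Definition active_station : nat -> nat :=
  nth 0 [seq oapp (@nat_of_ord K) 0 (dec j) | j <- enum [set j | dec j != None]].

Lemma active_pairP k : k < zf_dof dec -> exists j i,
  [/\ dec j = Some i, active_terminal k = j & active_station k = i].
Proof.
rewrite /active_terminal /active_station => lt_k; pose j := enum_val (Ordinal lt_k).
have : j \in [set j | dec j != None] by apply: enum_valP.
rewrite inE; case dec_j: (dec j) => [i|] // _; exists j, i.
by rewrite !(nth_map j) -?cardE // -(enum_val_nth j (Ordinal lt_k)) -/j dec_j.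
Qed.

Lemma active_terminal_lt k l :
  k < l < zf_dof dec -> active_terminal k < active_terminal l.
Proof.
case/andP=> lt_kl lt_l.
by apply: (sorted_ltn_nth ltn_trans 0 (sorted_enum_set _)) (lt_kl);
  rewrite inE size_map -cardE // (ltn_trans lt_kl).
Qed.

Lemma zf_not_mutually_heard j i m k : dec j = Some i -> dec m = Some k -> m != j ->
  connected L m i -> ~~ connected L j k.
Proof.
move=> dec_j dec_m neq_mj conn_mi; apply/negP => conn_jk.
have lt_mj : r m < r j.
  by apply: (zf_decoded_before schedule dec_j _ neq_mj conn_mi); rewrite dec_m.
suff : r j < r m by rewrite ltnNge ltnW.
by apply: (zf_decoded_before schedule dec_m _ _ conn_jk); rewrite ?dec_j // eq_sym.
Qed.

Lemma zf_decoding_chain :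
  decoding_chain L (zf_dof dec) active_station active_terminal.
Proof.
split=> [k|k lt_k|k lt_k]; last 2 first.
- by apply: active_terminal_lt; rewrite ltnSn.
- have lt_a : active_terminal k < active_terminal k.+1.
    by apply: active_terminal_lt; rewrite ltnSn.
  have [m [l [dec_m Dm Dl]]] := active_pairP lt_k.
  have [j [i [dec_j Dj Di]]] := active_pairP (ltnW lt_k).
  move: lt_a; rewrite Dm Dl Dj Di => lt_jm.
  have neq_mj : m != j by rewrite -val_eqE neq_ltn lt_jm orbT.
  have := zf_not_mutually_heard dec_j dec_m neq_mj.
  have := zf_connected schedule dec_j; have := zf_connected schedule dec_m.
  by rewrite /connected; lia.
- by move=> /active_pairP[j [i [/(zf_connected schedule) conn_ji -> ->]]].
Qed.

Lemma zf_bounded_overlap :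
  bounded_overlap L N (zf_dof dec) active_station active_terminal.
Proof.
move=> s m /andP[le_sm le_mN] lt_N; rewrite ltnNge [_ < active_station _]ltnNge -negb_and.
apply/negP => /andP[near_s near_N].
have gap := chain_station_gap zf_decoding_chain.
have [j [i [dec_j Dj _]]] := active_pairP (leq_ltn_trans le_mN lt_N).
have : #|listening_stations L dec j| <= N.
  by apply: (zf_listening_le schedule); rewrite dec_j.
rewrite leqNgt cardE -(size_map (@nat_of_ord K)) -[N.+1](size_iota s).
rewrite -(size_map active_station) uniq_leq_size //.
  rewrite map_inj_in_uniq ?iota_uniq // => k l; rewrite !mem_iota => le_k le_l eq_kl.
  have := gap k l; have := gap l k; rewrite eq_kl.
  by case: (ltngtP k l); lia.
move=> _ /mapP[k + ->]; rewrite mem_iota => le_k.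
have [l [h [dec_l _ Dh]]] := active_pairP (ltac:(lia) : k < zf_dof dec).
rewrite Dh map_f // mem_enum inE; apply/andP; split; last first.
  by apply/existsP; exists l; rewrite dec_l.
have := gap s k ltac:(lia); have := gap k (s + N) ltac:(lia).
by rewrite /connected -Dj -Dh; lia.
Qed.

End ScheduleChain.

Lemma eta_zf_upper K L N p q : 0 < N -> 0 < p ->
    (N + 1) * p <= (L + 2) * q -> 2 * N * p <= (L + 2 * N) * q ->
  eta_zf K L N * p <= K * q + (3 * N + 1) * p.
Proof.
move=> N_gt0 p_gt0; rewrite addn1 => slope_wide slope_jump.
rewrite -leq_divRL //; apply/eta_zf_leqP => dec r schedule; rewrite leq_divRL //.
apply: (chain_length_le (zf_decoding_chain schedule) N_gt0
          (zf_bounded_overlap schedule) slope_wide slope_jump) => k.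
by case/active_pairP=> [_ [i [_ _ ->]]].
Qed.

Section ShiftedScheme.

(* Every active terminal [j] is decoded [shift j] stations below its own. *)
Variables (K : nat) (act : pred nat) (shift : nat -> nat).

Definition shifted_station (j : 'I_K) : 'I_K :=
  Ordinal (leq_ltn_trans (leq_subr (shift j) j) (ltn_ord j)).

Definition shifted_dec : {ffun 'I_K -> option 'I_K} :=
  [ffun j : 'I_K => if act j then Some (shifted_station j) else None].

Lemma shifted_decP (j i : 'I_K) : shifted_dec j = Some i ->
  act j /\ nat_of_ord i = j - shift j.
Proof. by rewrite ffunE; case: ifP => // act_j [<-]. Qed.

Lemma shifted_dec_active (j : 'I_K) : (shifted_dec j != None) = act j.
Proof. by rewrite ffunE; case: ifP. Qed.

Lemma zf_dof_shifted : zf_dof shifted_dec = count act (iota 0 K).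
Proof.
rewrite /zf_dof cardE -val_enum_ord enumT count_map -size_filter.
by congr size; apply: eq_filter => j; rewrite /= inE shifted_dec_active.
Qed.

(* Only stations in a window of length [L.+1 <= p] hear a given terminal, so they
   can be counted through their residues modulo [p]. *)
Record shift_scheme L N p (r : {ffun 'I_K -> 'I_K}) : Prop := ShiftScheme {
  shift_window_lt : L < p;
  shift_le : forall j, act j -> shift j <= L;
  shift_decoded_before : forall j m : 'I_K, act j -> act m -> m != j :> nat ->
    j - shift j <= m <= j - shift j + L -> r m < r j;
  shift_residues : forall m, act m -> exists2 S : seq nat, size S <= N &
    forall j, act j -> j - shift j <= m <= j - shift j + L ->
      (j - shift j) %% p \in S
}.

Variables (L N p : nat) (r : {ffun 'I_K -> 'I_K}).
Hypothesis scheme : shift_scheme L N p r.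

Lemma shift_scheme_schedule : zf_schedule L N shifted_dec r.
Proof.
split=> [j i|j i m|m].
- move=> /shifted_decP[act_j Di].
  by have := shift_le scheme act_j; rewrite /connected; lia.
- move=> /shifted_decP[act_j Di]; rewrite shifted_dec_active /connected Di.
  exact: (shift_decoded_before scheme).
rewrite shifted_dec_active => /(shift_residues scheme)[S size_S in_S].
apply: leq_trans size_S; rewrite cardE -(size_map (fun i : 'I_K => i %% p)).
apply: uniq_leq_size => [|_ /mapP[i + ->]]; last first.
  rewrite mem_enum inE => /andP[near_i /existsP[j /eqP/shifted_decP[act_j Di]]].
  by move: near_i; rewrite /connected Di => /(in_S j act_j).
rewrite map_inj_in_uniq ?enum_uniq // => i k; rewrite !mem_enum !inE /connected.
move=> /andP[near_i _] /andP[near_k _] eq_ik; apply: val_inj => /=.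
wlog le_ik : i k near_i near_k eq_ik / i <= k.
  by case: (leqP i k) => [|/ltnW] le_ik sym; [|symmetry]; apply: sym.
have : p %| k - i by rewrite -eqn_mod_dvd // eq_ik.
have := shift_window_lt scheme.
by case: (posnP (k - i)) => [|lt_ik lt_Lp /(dvdn_leq lt_ik)]; lia.
Qed.

Lemma shift_scheme_count_le : count act (iota 0 K) <= eta_zf K L N.
Proof. by rewrite -zf_dof_shifted; apply: zf_dof_le_eta shift_scheme_schedule. Qed.

Lemma shift_scheme_periodic_le : (forall j, act (j %% p) = act j) ->
  K * count act (iota 0 p) <= eta_zf K L N * p + p * count act (iota 0 p).
Proof.
move=> /(leq_count_periodic K (leq_ltn_trans (leq0n L) (shift_window_lt scheme))).
by move=> /leq_trans; apply; rewrite leq_add2r leq_mul // shift_scheme_count_le.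
Qed.

End ShiftedScheme.

Lemma eta_zf_full K L N : L < N -> eta_zf K L N = K.
Proof.
move=> lt_LN; apply/eqP; rewrite eqn_leq eta_zf_le -{1}(size_iota 0 K) -count_predT.
apply: (@shift_scheme_count_le K predT (fun=> 0) L N L.+1 [ffun j => rev_ord j]).
split=> // [j m _ _ neq_mj|m _].
  by rewrite !ffunE /=; have := ltn_ord m; lia.
exists (iota 0 L.+1); first by rewrite size_iota.
by move=> j _ _; rewrite mem_iota ltn_mod.
Qed.

(* In each block of [L + 2] indices, terminals [0, ..., N - 1] are decoded at their
   own stations and terminal [L + 1] at station [N], from the last to the first. *)
Definition dense_active L N j := (j %% (L + 2) < N) || (j %% (L + 2) == L + 1).

Definition dense_shift L N j := if j %% (L + 2) < N then 0 else L + 1 - N.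

Lemma dense_residue_le L N j : N <= L -> dense_active L N j ->
  (j - dense_shift L N j) %% (L + 2) <= N.
Proof.
rewrite /dense_active /dense_shift => le_NL.
case: ltnP => [|le_Nj /= /eqP Dj]; first by rewrite subn0; lia.
by rewrite modnB_small; lia.
Qed.

Lemma dense_shift_scheme K L N : 0 < N <= L ->
  @shift_scheme K (dense_active L N) (dense_shift L N) L N (L + 2)
    [ffun j => rev_ord j].
Proof.
move=> le_N; split=> [|j _|j m act_j act_m neq_mj near_m|m act_m].
- by lia.
- by rewrite /dense_shift; case: ifP; lia.
- rewrite !ffunE /=; suff : j < m by have := ltn_ord m; lia.
  rewrite ltnNge; apply/negP => le_mj.
  move: act_j near_m; rewrite /dense_shift /dense_active.
  case: ltnP => [|le_Nj /= /eqP Dj near_m]; first by lia.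
  have := @modnB_small (L + 2) j (j - m) ltac:(lia).
  by rewrite subKn // => Dm; move: act_m; rewrite /dense_active Dm; lia.
exists (rem (m.+1 %% (L + 2)) (iota 0 N.+1)).
  rewrite size_rem ?size_iota // mem_iota modnS.
  case: ifP => // ndvd_m; have := @ltn_pmod m.+1 (L + 2) ltac:(lia).
  by rewrite modnS ndvd_m; move: act_m; rewrite /dense_active; lia.
move=> j act_j near_m; rewrite mem_rem_uniq ?iota_uniq // inE mem_iota leq0n ltnS.
rewrite dense_residue_le ?andbT; [|by lia|by []].
rewrite eq_sym eqn_mod_dvd; last by lia.
by apply/negP => /dvdn_leq; lia.
Qed.

Lemma dense_active_count L N : N <= L ->
  count (dense_active L N) (iota 0 (L + 2)) = N + 1.
Proof.
move=> le_NL.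
have in_block o : o < L + 2 -> dense_active L N o = (o < N) || (o == L + 1).
  by move=> lt_o; rewrite /dense_active modn_small.
rewrite [in iota 0 _](_ : L + 2 = N + (L + 1 - N + 1)); last by lia.
rewrite !iotaD !count_cat (@count_iota_const _ true) => [|o lt_o]; last first.
  by rewrite in_block; lia.
rewrite (@count_iota_const _ false) => [|o lt_o]; last by rewrite in_block; lia.
by rewrite (@count_iota_const _ true) => [|o lt_o]; last rewrite in_block; lia.
Qed.

Lemma eta_zf_lower_dense K L N : 0 < N <= L ->
  K * (N + 1) <= eta_zf K L N * (L + 2) + (L + 2) * (N + 1).
Proof.
move=> le_N; have := shift_scheme_periodic_le (dense_shift_scheme K le_N).
rewrite dense_active_count; last by case/andP: le_N.
by apply=> j; rewrite /dense_active modn_mod.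
Qed.

(* In each block of [2 * N + L] indices the first [L] terminals are silent, the next
   [N] are decoded at the first [N] stations, from the first to the last, and the
   last [N] at their own stations, from the last to the first. *)
Definition sparse_active L N j := L <= j %% (2 * N + L).

Definition sparse_shift L N j := if j %% (2 * N + L) < L + N then L else 0.

Definition sparse_order K L N : {ffun 'I_K -> 'I_K} :=
  [ffun j : 'I_K => if j %% (2 * N + L) < L + N then j else rev_ord j].

Lemma sparse_residue L N j : 0 < N -> sparse_active L N j ->
  (j - sparse_shift L N j) %% (2 * N + L) < N \/
  L + N <= (j - sparse_shift L N j) %% (2 * N + L) < 2 * N + L.
Proof.
rewrite /sparse_active /sparse_shift => N_gt0 act_j.
rewrite modnB_small; last by case: ifP.
have := @ltn_pmod j (2 * N + L) ltac:(lia); move: (j %% _) act_j => o.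
by case: (ltnP o (L + N)); lia.
Qed.

Lemma sparse_shift_scheme K L N : 0 < N ->
  @shift_scheme K (sparse_active L N) (sparse_shift L N) L N (2 * N + L)
    (sparse_order K L N).
Proof.
move=> N_gt0; set p := 2 * N + L.
have mod_below j m : m <= j -> j - m <= j %% p -> m %% p = j %% p - (j - m).
  by move=> le_mj le_j; rewrite -modnB_small // subKn.
split=> [|j _|j m|m act_m].
- by rewrite /p; lia.
- by rewrite /sparse_shift; case: ifP; lia.
- rewrite /sparse_active /sparse_shift !ffunE -/p => act_j act_m neq_mj.
  have le_mod := leq_mod j p; case: (ltnP (j %% p)) => [lt_j | le_j] near_m.
    have -> : m %% p < L + N by rewrite (mod_below j); lia.
    by lia.
  have le_m : L + N <= m %% p by have := mod_below m j; lia.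
  by rewrite [_ %% _ < _]ltnNge le_m /=; have := ltn_ord m; lia.
exists (if m %% p < L + N then iota 0 N else iota (L + N) N).
  by case: ifP; rewrite size_iota.
move=> j /(sparse_residue N_gt0); move: (j - _) => b residue_b near_m.
have : b %% p <= m %% p <= b %% p + L.
  by rewrite /sparse_active -/p in act_m; rewrite (mod_below m b); lia.
move: residue_b; rewrite -/p; move: (b %% p) (m %% p) => b_p m_p.
by case: (ltnP m_p (L + N)); rewrite mem_iota /p; lia.
Qed.

Lemma sparse_active_count L N :
  count (sparse_active L N) (iota 0 (2 * N + L)) = 2 * N.
Proof.
have in_block o : o < 2 * N + L -> sparse_active L N o = (L <= o).
  by move=> lt_o; rewrite /sparse_active modn_small.
rewrite [in iota 0 _]addnC iotaD count_cat (@count_iota_const _ false) => [|o lt_o].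
  by rewrite (@count_iota_const _ true) => [|o lt_o]; last rewrite in_block; lia.
by rewrite in_block; lia.
Qed.

Lemma eta_zf_lower_sparse K L N : 0 < N ->
  K * (2 * N) <= eta_zf K L N * (2 * N + L) + (2 * N + L) * (2 * N).
Proof.
move=> N_gt0; have := shift_scheme_periodic_le (sparse_shift_scheme K L N_gt0).
rewrite sparse_active_count; by apply=> j; rewrite /sparse_active modn_mod.
Qed.

Lemma Un_cv_INR_ratio (u : nat -> nat) (p q b c : nat) : 0 < p ->
    (forall K, K * q <= u K * p + b) -> (forall K, u K * p <= K * q + c) ->
  Un_cv (fun K => INR (u K) / INR K)%R (INR q / INR p).
Proof.
move=> p_gt0 lower upper eps eps_gt0; set e := INR (b + c).
have p_pos : (0 < INR p)%R by apply: lt_0_INR; lia.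
have [k lt_k] := INR_unbounded (e / (INR p * eps)).
exists k.+1 => K le_kK; rewrite /R_dist.
have K_pos : (0 < INR K)%R by apply: lt_0_INR; lia.
have Kp_pos : (0 < INR K * INR p)%R by apply: Rmult_lt_0_compat.
have lt_kK : (INR k < INR K)%R by apply: lt_INR; lia.
have dist_le : (Rabs (INR (u K) * INR p - INR K * INR q) <= e)%R.
  have : (INR K * INR q <= INR (u K) * INR p + e)%R.
    by rewrite -!mult_INR -plus_INR; apply: le_INR; have := lower K; lia.
  have : (INR (u K) * INR p <= INR K * INR q + e)%R.
    by rewrite -!mult_INR -plus_INR; apply: le_INR; have := upper K; lia.
  by move=> ? ?; apply: Rabs_le; lra.
have lt_e : (e < eps * (INR K * INR p))%R.
  have pe_pos : (0 < INR p * eps)%R by apply: Rmult_lt_0_compat.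
  have := Rmult_lt_compat_r _ _ _ pe_pos (Rlt_trans _ _ _ lt_k lt_kK).
  by rewrite /Rdiv Rmult_assoc Rinv_l; lra.
apply: (Rmult_lt_reg_r (INR K * INR p)) => //.
rewrite -{1}(Rabs_pos_eq (INR K * INR p)) -?Rabs_mult; last by lra.
have -> : ((INR (u K) / INR K - INR q / INR p) * (INR K * INR p) =
  INR (u K) * INR p - INR K * INR q)%R by field; lra.
by lra.
Qed.

Theorem theorem1 (L Nc : nat) :
  (1 <= L)%N -> (1 <= Nc)%N ->
  [/\ (L + 1 <= Nc)%N -> Un_cv (tau_seq L Nc) 1%R,
      (L <= 2 * Nc)%N && (Nc <= L)%N ->
        Un_cv (tau_seq L Nc) (INR (Nc + 1) / INR (L + 2))%R &
      (2 * Nc < L)%N ->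
        Un_cv (tau_seq L Nc) (INR (2 * Nc) / INR (2 * Nc + L))%R].
Proof.
move=> _ N_gt0; split=> [lt_LN | /andP[le_L2N le_NL] | lt_2NL].
- have -> : 1%R = (INR 1 / INR 1)%R by rewrite /= Rdiv_1_r.
  by apply: (@Un_cv_INR_ratio _ _ _ 0 0) => // K; rewrite eta_zf_full; lia.
- apply: Un_cv_INR_ratio => [|K|K]; first by rewrite addn2.
    by apply: eta_zf_lower_dense; rewrite N_gt0.
  by apply: eta_zf_upper => //; [rewrite addn2 | rewrite mulnC | nia].
- apply: Un_cv_INR_ratio => [|K|K]; first by rewrite addn_gt0 muln_gt0 N_gt0.
    exact: eta_zf_lower_sparse.
  apply: eta_zf_upper => //; [|by nia | by rewrite mulnC addnC].
  by rewrite addn_gt0 muln_gt0 N_gt0.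
Qed.
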